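(* Let $\tilde x:\Sigma\to\mathbb{I}^3$ be a conformal immersion of a simply connected domain $\Sigma\subset\mathbb{C}$ (with coordinate $z=u+iv$), with orientation such that it admits an adapted frame in $\mathrm{SU}(1,0,1)$ (as defined in the context). Then locally, in the coordinates $(\mathbf{l},\mathbf{x},\mathbf{y})$ of $\mathbb{I}^3$ and up to a constant of integration, $\tilde x$ can be represented as $$\tilde x=\operatorname{Re}\int\left(\frac{\beta}{\alpha},\,1,\,-i\right)\alpha^2\,\mathrm{d}z$$ for some non-vanishing holomorphic function $\alpha:\Sigma\to\mathbb{C}$ and a complex-valued function $\beta:\Sigma\to\mathbb{C}$ satisfying $$\alpha\beta_{\bar z}-\bar\alpha\bar\beta_z=0.$$ The metric of $\tilde x$ is then $$\mathrm{d}s^2=|\alpha|^4\,\mathrm{d}z\,\mathrm{d}\bar z,$$ the mean curvature $\tilde H$ of $\tilde x$ is $$\tilde H=\frac{\beta_{\bar z}}{\bar\alpha|\alpha|^2},$$ and the lightlike Gauss map $\tilde g:\Sigma\to\mathcal{L}$ of $\tilde x$ is $$\tilde g=-\tfrac12\left(1+\left|\tfrac{\beta}{\alpha}\right|^2,\;2\operatorname{Re}\tfrac{\beta}{\alpha},\;-2\operatorname{Im}\tfrac{\beta}{\alpha},\;-1+\left|\tfrac{\beta}{\alpha}\right|^2\right)^t.$$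
   Context: All maps are smooth. $\mathbb{L}^4$ is $\mathbb{R}^4$ with $\langle x,y\rangle=-x_0y_0+x_1y_1+x_2y_2+x_3y_3$, and $\mathcal{L}=\{y\in\mathbb{L}^4:\langle y,y\rangle=0\}$. With $\mathfrak{p}=(1,0,0,1)^t$, isotropic $3$-space is $\mathbb{I}^3=\{x\in\mathbb{L}^4:\langle x,\mathfrak{p}\rangle=0\}=\{(\mathbf{l},\mathbf{x},\mathbf{y},\mathbf{l})^t\}$ with induced metric $\mathrm{d}\mathbf{x}^2+\mathrm{d}\mathbf{y}^2$; a point $(\mathbf{l},\mathbf{x},\mathbf{y},\mathbf{l})^t$ is also written $(\mathbf{l},\mathbf{x},\mathbf{y})$. $\mathbb{L}^4$ is identified with $2\times2$ Hermitian matrices by $x\sim X=\begin{pmatrix}x_0+x_3&x_1+ix_2\\ x_1-ix_2&x_0-x_3\end{pmatrix}$. A conformal immersion $x:\Sigma\to\mathbb{I}^3$ is an immersion whose induced metric is Riemannian and equals $e^{2\sigma}(\mathrm{d}u^2+\mathrm{d}v^2)=e^{2\sigma}\mathrm{d}z\,\mathrm{d}\bar z$ for some $\sigma:\Sigma\to\mathbb{R}$. Its lightlike Gauss map is the unique $g:\Sigma\to\mathcal{L}$ with $\langle g,\mathfrak{p}\rangle=1$ and $\langle\mathrm{d}x,g\rangle=0$. Its mean curvature is $H=2e^{-2\sigma}\langle x_{z\bar z},g\rangle$, where $\partial_z=\tfrac12(\partial_u-i\partial_v)$, $\partial_{\bar z}=\tfrac12(\partial_u+i\partial_v)$. $\mathrm{SU}(1,0,1)=\left\{\begin{pmatrix}e^{i\theta}&w\\0&e^{-i\theta}\end{pmatrix}:\theta\in\mathbb{R},\,w\in\mathbb{C}\right\}$.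 An adapted frame of a conformal immersion (with matrix form $X$) is a map $F:\Sigma\to\mathrm{SU}(1,0,1)$ with $X_u=e^{\sigma}FE_1F^*$ and $X_v=e^{\sigma}FE_2F^*$, where $E_1=\begin{pmatrix}0&1\\1&0\end{pmatrix}$, $E_2=\begin{pmatrix}0&i\\-i&0\end{pmatrix}$ and $F^*$ is the conjugate transpose. (Having one means that the projection $(\mathbf{x},\mathbf{y})$ of the immersion is orientation preserving, i.e. $\mathbf{x}+i\mathbf{y}$ is holomorphic in $z$.) *)

(* Defs.v *)
From Stdlib Require Import Reals ClassicalEpsilon.
From Coquelicot Require Import Coquelicot.
Open Scope R_scope.

(* Maps on a domain of the plane are total functions on [C = R * R]; only their
   values on the domain matter, and the point u + i v is the pair (u, v). *)

(** * Partial derivatives and smoothness *)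

Definition du (f : C -> R) (z : C) : R := Derive (fun u => f (u, snd z)) (fst z).
Definition dv (f : C -> R) (z : C) : R := Derive (fun v => f (fst z, v)) (snd z).

Definition Cdu (f : C -> C) (z : C) : C :=
  (du (fun w => Re (f w)) z, du (fun w => Im (f w)) z).
Definition Cdv (f : C -> C) (z : C) : C :=
  (dv (fun w => Re (f w)) z, dv (fun w => Im (f w)) z).

Definition d_z (f : C -> C) (z : C) : C := (/ 2 * (Cdu f z - Ci * Cdv f z))%C.
Definition d_zbar (f : C -> C) (z : C) : C := (/ 2 * (Cdu f z + Ci * Cdv f z))%C.

(* The total operator [Derive] gives junk where there is no derivative, so
   existence is demanded at every order. *)
Fixpoint class_C (k : nat) (Sigma : C -> Prop) (f : C -> R) : Prop :=
  (forall z, Sigma z -> continuous f z) /\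
  match k with
  | O => True
  | S k' =>
      (forall z, Sigma z ->
         ex_derive (fun u => f (u, snd z)) (fst z) /\
         ex_derive (fun v => f (fst z, v)) (snd z)) /\
      class_C k' Sigma (du f) /\ class_C k' Sigma (dv f)
  end.

Definition smooth (Sigma : C -> Prop) (f : C -> R) : Prop :=
  forall k, class_C k Sigma f.

Definition Csmooth (Sigma : C -> Prop) (f : C -> C) : Prop :=
  smooth Sigma (fun z => Re (f z)) /\ smooth Sigma (fun z => Im (f z)).

(* Differentiability in the complex sense: the scalars are [C_AbsRing]. *)
Definition holomorphic (Sigma : C -> Prop) (f : C -> C) : Prop :=
  forall z, Sigma z -> @ex_derive C_AbsRing C_NormedModule f z.

(** * Simply connected domains *)

Definition unit_interval (t : R) : Prop := 0 <= t <= 1.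

Definition continuous_path (Sigma : C -> Prop) (g : R -> C) : Prop :=
  continuous_on unit_interval g /\ forall t, unit_interval t -> Sigma (g t).

(* For open sets, connectedness and path-connectedness coincide. *)
Definition domain (Sigma : C -> Prop) : Prop :=
  open Sigma /\ (exists z, Sigma z) /\
  forall z w, Sigma z -> Sigma w ->
    exists g, continuous_path Sigma g /\ g 0 = z /\ g 1 = w.

(* The first argument of the homotopy is the deformation parameter. *)
Definition null_homotopic (Sigma : C -> Prop) (g : R -> C) : Prop :=
  exists h : R * R -> C,
    continuous_on (fun p => unit_interval (fst p) /\ unit_interval (snd p)) h /\
    (forall s t, unit_interval s -> unit_interval t -> Sigma (h (s, t))) /\
    (forall t, unit_interval t -> h (0, t) = g t /\ h (1, t) = g 0) /\
    (forall s, unit_interval s -> h (s, 0) = g 0 /\ h (s, 1) = g 0).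

Definition simply_connected_domain (Sigma : C -> Prop) : Prop :=
  domain Sigma /\
  forall g, continuous_path Sigma g -> g 0 = g 1 -> null_homotopic Sigma g.

(** * Lorentz space and isotropic space *)

Record vec4 (A : Type) : Type := Vec4 { x0 : A; x1 : A; x2 : A; x3 : A }.
Arguments Vec4 {A}.
Arguments x0 {A}.
Arguments x1 {A}.
Arguments x2 {A}.
Arguments x3 {A}.

Definition L4 : Type := vec4 R.

Definition vmap {A B : Type} (f : A -> B) (x : vec4 A) : vec4 B :=
  Vec4 (f (x0 x)) (f (x1 x)) (f (x2 x)) (f (x3 x)).

Definition vplus (x y : L4) : L4 :=
  Vec4 (x0 x + x0 y) (x1 x + x1 y) (x2 x + x2 y) (x3 x + x3 y).

Definition vscal (a : R) (x : L4) : L4 := vmap (Rmult a) x.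

Definition vzero : L4 := Vec4 0 0 0 0.

Definition lorentz (x y : L4) : R :=
  - (x0 x * x0 y) + x1 x * x1 y + x2 x * x2 y + x3 x * x3 y.

(* The complex bilinear (not sesquilinear) extension of [lorentz]. *)
Definition Clorentz (x y : vec4 C) : C :=
  (- (x0 x * x0 y) + x1 x * x1 y + x2 x * x2 y + x3 x * x3 y)%C.

Definition pp : L4 := Vec4 1 0 0 1.

Definition isotropic_space (x : L4) : Prop := lorentz x pp = 0.

Definition iso_point (l x y : R) : L4 := Vec4 l x y l.

Definition light_cone (y : L4) : Prop := lorentz y y = 0.

(** * Derivatives of maps into Lorentz space *)

Definition vsmooth (Sigma : C -> Prop) (x : C -> L4) : Prop :=
  smooth Sigma (fun z => x0 (x z)) /\ smooth Sigma (fun z => x1 (x z)) /\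
  smooth Sigma (fun z => x2 (x z)) /\ smooth Sigma (fun z => x3 (x z)).

Definition vdu (x : C -> L4) (z : C) : L4 :=
  Vec4 (du (fun w => x0 (x w)) z) (du (fun w => x1 (x w)) z)
       (du (fun w => x2 (x w)) z) (du (fun w => x3 (x w)) z).
Definition vdv (x : C -> L4) (z : C) : L4 :=
  Vec4 (dv (fun w => x0 (x w)) z) (dv (fun w => x1 (x w)) z)
       (dv (fun w => x2 (x w)) z) (dv (fun w => x3 (x w)) z).

Definition vd_z (x : C -> vec4 C) (z : C) : vec4 C :=
  Vec4 (d_z (fun w => x0 (x w)) z) (d_z (fun w => x1 (x w)) z)
       (d_z (fun w => x2 (x w)) z) (d_z (fun w => x3 (x w)) z).
Definition vd_zbar (x : C -> vec4 C) (z : C) : vec4 C :=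
  Vec4 (d_zbar (fun w => x0 (x w)) z) (d_zbar (fun w => x1 (x w)) z)
       (d_zbar (fun w => x2 (x w)) z) (d_zbar (fun w => x3 (x w)) z).

(* The differential at z, on the tangent vector (fst h) d/du + (snd h) d/dv. *)
Definition differential (x : C -> L4) (z h : C) : L4 :=
  vplus (vscal (fst h) (vdu x z)) (vscal (snd h) (vdv x z)).

Definition immersion (Sigma : C -> Prop) (x : C -> L4) : Prop :=
  vsmooth Sigma x /\
  forall z h, Sigma z -> differential x z h = vzero -> h = 0%C.

(* The induced metric as a quadratic form on tangent vectors. *)
Definition induced_metric (x : C -> L4) (z h : C) : R :=
  lorentz (differential x z h) (differential x z h).

Definition conformal_immersion
    (Sigma : C -> Prop) (x : C -> L4) (sigma : C -> R) : Prop :=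
  (forall z, Sigma z -> isotropic_space (x z)) /\
  immersion Sigma x /\
  smooth Sigma sigma /\
  forall z h, Sigma z ->
    induced_metric x z h = exp (2 * sigma z) * (fst h ^ 2 + snd h ^ 2).

(* For an immersion as above exactly one vector satisfies the three conditions
   at each z, so [epsilon] merely names it. *)
Definition lightlike_gauss_map (x : C -> L4) (z : C) : L4 :=
  epsilon (inhabits vzero) (fun g =>
    light_cone g /\ lorentz g pp = 1 /\
    forall h, lorentz (differential x z h) g = 0).

(* Written in [C] since [d_z] and [d_zbar] are complex operators. *)
Definition mean_curvature (x : C -> L4) (sigma : C -> R) (z : C) : C :=
  (2 * exp (- 2 * sigma z)
     * Clorentz (vd_zbar (vd_z (fun w => vmap RtoC (x w))) z)
                (vmap RtoC (lightlike_gauss_map x z)))%C.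

(** * Hermitian matrices and adapted frames *)

Definition M2 : Type := @matrix C 2 2.

Definition entry (A : M2) (i j : nat) : C := coeff_mat (0 : C) A i j.

Definition mat2 (a b c d : C) : M2 :=
  mk_matrix 2 2 (fun i j =>
    match i, j with
    | O, O => a
    | O, _ => b
    | _, O => c
    | _, _ => d
    end).

Definition Mmult2 (A B : M2) : M2 := @Mmult C_Ring 2 2 2 A B.

Definition Mscal (a : C) (A : M2) : M2 :=
  mk_matrix 2 2 (fun i j => a * entry A i j)%C.

Definition Mstar (A : M2) : M2 :=
  mk_matrix 2 2 (fun i j => Cconj (entry A j i)).

Definition Mdu (A : C -> M2) (z : C) : M2 :=
  mk_matrix 2 2 (fun i j => Cdu (fun w => entry (A w) i j) z).
Definition Mdv (A : C -> M2) (z : C) : M2 :=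
  mk_matrix 2 2 (fun i j => Cdv (fun w => entry (A w) i j) z).

Definition hermitian_form (x : L4) : M2 :=
  mat2 (RtoC (x0 x + x3 x))  (x1 x + Ci * x2 x)%C
       (x1 x - Ci * x2 x)%C  (RtoC (x0 x - x3 x)).

Definition expi (theta : R) : C := (cos theta, sin theta).

Definition SU101 (A : M2) : Prop :=
  exists (theta : R) (w : C), A = mat2 (expi theta) w 0 (expi (- theta)).

Definition frame_E1 : M2 := mat2 0 1 1 0.
Definition frame_E2 : M2 := mat2 0 Ci (- Ci) 0.

Definition adapted_frame (Sigma : C -> Prop) (x : C -> L4) (sigma : C -> R)
    (F : C -> M2) : Prop :=
  (forall i j, (i < 2)%nat -> (j < 2)%nat ->
     Csmooth Sigma (fun z => entry (F z) i j)) /\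
  forall z, Sigma z ->
    SU101 (F z) /\
    Mdu (fun w => hermitian_form (x w)) z =
      Mscal (exp (sigma z)) (Mmult2 (Mmult2 (F z) frame_E1) (Mstar (F z))) /\
    Mdv (fun w => hermitian_form (x w)) z =
      Mscal (exp (sigma z)) (Mmult2 (Mmult2 (F z) frame_E2) (Mstar (F z))).

(** * Integration along paths *)

(* A C^1 path in Sigma, with velocity dg. A C^1 map on [0,1] extends to a C^1
   map on R, so two-sided derivatives at the endpoints cost nothing. *)
Definition C1_path (Sigma : C -> Prop) (g dg : R -> C) : Prop :=
  forall t, unit_interval t ->
    Sigma (g t) /\
    @is_derive R_AbsRing C_R_NormedModule g t (dg t) /\
    continuous dg t.

Definition path_integral (f : C -> C) (g dg : R -> C) : C :=
  @RInt C_R_CompleteNormedModule (fun t => (f (g t) * dg t)%C) 0 1.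

(* x = Re int (f1, f2, f3) dz in the coordinates (l, x, y) of isotropic space,
   up to a constant of integration: along every path the increment of x is the
   real part of the integral. *)
Definition re_integral_of (Sigma : C -> Prop) (x : C -> L4)
    (f1 f2 f3 : C -> C) : Prop :=
  forall g dg, C1_path Sigma g dg ->
    x (g 1) = vplus (x (g 0))
                (iso_point (Re (path_integral f1 g dg))
                           (Re (path_integral f2 g dg))
                           (Re (path_integral f3 g dg))).

Definition weierstrass_representation (Sigma : C -> Prop) (x : C -> L4)
    (alpha beta : C -> C) : Prop :=
  holomorphic Sigma alpha /\
  (forall z, Sigma z -> alpha z <> 0%C) /\
  Csmooth Sigma beta /\
  (forall z, Sigma z ->
     (alpha z * d_zbar beta z
        - Cconj (alpha z) * d_z (fun w => Cconj (beta w)) z = 0)%C) /\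
  re_integral_of Sigma x
    (fun z => beta z / alpha z * alpha z ^ 2)%C
    (fun z => 1 * alpha z ^ 2)%C
    (fun z => - Ci * alpha z ^ 2)%C.

(* Main.v *)
Require Import Defs.
From Stdlib Require Import Reals Lra ClassicalEpsilon.
From Coquelicot Require Import Coquelicot.
Open Scope R_scope.

(** Write F = ((a, b), (0, conj a)) with |a| = 1 for the adapted frame. Expanding
    X_u and X_v shows that alpha := e^(sigma/2) a and beta := e^(sigma/2) conj b
    satisfy, in the coordinates (l, x, y) of the immersion,
      dl = Re (alpha beta dz),  dx = Re (alpha^2 dz),  dy = Re (- i alpha^2 dz)
    ([frame_gradient]); integrating along paths gives the representation
    ([path_integral_of_gradient]).

    The remaining conditions on alpha and beta come from a single remark: if
    dp = Re (f dz) for a real function p of class C^2, then f = 2 p_z, so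
    2 f_zbar is the Laplacian of p, which is real ([Im_d_zbar_re_primitive]).
    For x and y this says that d_zbar (alpha^2) and - i d_zbar (alpha^2) are both
    real, so d_zbar (alpha^2) = 0; since alpha is continuously differentiable and
    has no zero, alpha is holomorphic ([holomorphic_sqrt_gradient]). For l it says
    that d_zbar (alpha beta) = alpha d_zbar beta is real, which is the
    compatibility condition between alpha and beta.

    Conversely, any representation determines the three differentials above:
    differentiate the integral along short segments ([gradient_of_path_integral]).
    The metric, the Gauss map and the mean curvature are then algebra. The metric
    is dx^2 + dy^2 = |alpha^2 dz|^2. For a lightlike g with <g, p> = 1 the form
    <dx, g> is Re (alpha (beta + k alpha) dz) with k = g_1 - i g_2, so it vanishes
    exactly when k = - beta / alpha ([gauss_conditions_iff]). Finally x_z zbar is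
    alpha beta_zbar / 2 times p, because only l fails to be harmonic
    ([weierstrass_d_zbar_d_z]), and <p, g> = 1. *)

(** * Partial derivatives *)

Definition has_partials (f : C -> R) (z : C) (a b : R) : Prop :=
  is_derive (fun u => f (u, snd z)) (fst z) a /\
  is_derive (fun v => f (fst z, v)) (snd z) b.

Definition Chas_partials (f : C -> C) (z a b : C) : Prop :=
  has_partials (fun w => Re (f w)) z (Re a) (Re b) /\
  has_partials (fun w => Im (f w)) z (Im a) (Im b).

Lemma has_partials_du f z a b : has_partials f z a b -> du f z = a.
Proof. intros [H _]. apply is_derive_unique, H. Qed.

Lemma has_partials_dv f z a b : has_partials f z a b -> dv f z = b.
Proof. intros [_ H]. apply is_derive_unique, H. Qed.

Lemma Chas_partials_Cdu f z a b : Chas_partials f z a b -> Cdu f z = a.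
Proof.
  intros [H1 H2]. unfold Cdu.
  rewrite (has_partials_du _ _ _ _ H1), (has_partials_du _ _ _ _ H2).
  now destruct a.
Qed.

Lemma Chas_partials_Cdv f z a b : Chas_partials f z a b -> Cdv f z = b.
Proof.
  intros [H1 H2]. unfold Cdv.
  rewrite (has_partials_dv _ _ _ _ H1), (has_partials_dv _ _ _ _ H2).
  now destruct b.
Qed.

Lemma locally_horizontal (P : C -> Prop) (z : C) :
  locally z P -> locally (fst z) (fun u => P (u, snd z)).
Proof.
  intros [e He]. exists e. intros u Hu. apply He. split; [exact Hu|].
  apply ball_center.
Qed.

Lemma locally_vertical (P : C -> Prop) (z : C) :
  locally z P -> locally (snd z) (fun v => P (fst z, v)).
Proof.
  intros [e He]. exists e. intros v Hv. apply He. split; [|exact Hv].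
  apply ball_center.
Qed.

Lemma has_partials_ext_loc (f g : C -> R) (z : C) a b :
  locally z (fun w : C => f w = g w) -> has_partials f z a b -> has_partials g z a b.
Proof.
  intros E [H1 H2]. split.
  - refine (is_derive_ext_loc _ _ _ _ _ H1).
    exact (locally_horizontal _ _ E).
  - refine (is_derive_ext_loc _ _ _ _ _ H2).
    exact (locally_vertical _ _ E).
Qed.

Lemma du_ext_loc (f g : C -> R) (z : C) :
  locally z (fun w : C => f w = g w) -> du f z = du g z.
Proof. intros E. apply Derive_ext_loc. exact (locally_horizontal _ _ E). Qed.

Lemma dv_ext_loc (f g : C -> R) (z : C) :
  locally z (fun w : C => f w = g w) -> dv f z = dv g z.
Proof. intros E. apply Derive_ext_loc. exact (locally_vertical _ _ E). Qed.

Lemma locally_ext_of_open (Sigma : C -> Prop) (f g : C -> R) z :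
  open Sigma -> (forall w, Sigma w -> f w = g w) -> Sigma z ->
  locally z (fun w : C => f w = g w).
Proof. intros HO E Hz. generalize (HO z Hz). apply filter_imp, E. Qed.

Lemma has_partials_plus f g z a b c d :
  has_partials f z a b -> has_partials g z c d ->
  has_partials (fun w => f w + g w) z (a + c) (b + d).
Proof.
  intros [H1 H2] [H3 H4]. split.
  - exact (is_derive_plus _ _ _ _ _ H1 H3).
  - exact (is_derive_plus _ _ _ _ _ H2 H4).
Qed.

Lemma has_partials_opp f z a b :
  has_partials f z a b -> has_partials (fun w => - f w) z (- a) (- b).
Proof.
  intros [H1 H2]. split.
  - exact (is_derive_opp _ _ _ H1).
  - exact (is_derive_opp _ _ _ H2).
Qed.

Lemma has_partials_mult f g z a b c d :
  has_partials f z a b -> has_partials g z c d ->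
  has_partials (fun w => f w * g w) z (a * g z + f z * c) (b * g z + f z * d).
Proof.
  destruct z as [u v]. intros [H1 H2] [H3 H4]. split.
  - exact (Derive.is_derive_mult _ _ _ _ _ H1 H3).
  - exact (Derive.is_derive_mult _ _ _ _ _ H2 H4).
Qed.

Lemma has_partials_exp f z a b :
  has_partials f z a b ->
  has_partials (fun w => exp (f w)) z (a * exp (f z)) (b * exp (f z)).
Proof.
  destruct z as [u v]. intros [H1 H2]. split.
  - exact (is_derive_comp exp (fun u => f (u, v)) _ _ _ (is_derive_exp _) H1).
  - exact (is_derive_comp exp (fun v => f (u, v)) _ _ _ (is_derive_exp _) H2).
Qed.

Lemma has_partials_eq f z a b a' b' :
  has_partials f z a b -> a = a' -> b = b' -> has_partials f z a' b'.
Proof. now intros H <- <-. Qed.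

Lemma Chas_partials_mult f g z a b c d :
  Chas_partials f z a b -> Chas_partials g z c d ->
  Chas_partials (fun w => f w * g w)%C z
    (a * g z + f z * c)%C (b * g z + f z * d)%C.
Proof.
  intros [F1 F2] [G1 G2]. split.
  - refine (has_partials_eq _ _ _ _ _ _ (has_partials_plus _ _ _ _ _ _ _
      (has_partials_mult _ _ _ _ _ _ _ F1 G1)
      (has_partials_opp _ _ _ _ (has_partials_mult _ _ _ _ _ _ _ F2 G2))) _ _);
    unfold Re, Im; simpl; ring.
  - refine (has_partials_eq _ _ _ _ _ _ (has_partials_plus _ _ _ _ _ _ _
      (has_partials_mult _ _ _ _ _ _ _ F1 G2)
      (has_partials_mult _ _ _ _ _ _ _ F2 G1)) _ _);
    unfold Re, Im; simpl; ring.
Qed.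

(** * Functions of class C^k *)

Lemma class_C_continuous k Sigma f :
  class_C k Sigma f -> forall z, Sigma z -> continuous f z.
Proof. destruct k; intros [H _]; exact H. Qed.

Lemma class_C_partials k Sigma f z :
  class_C (S k) Sigma f -> Sigma z -> has_partials f z (du f z) (dv f z).
Proof.
  intros (_ & H & _) Hz. destruct (H z Hz) as [H1 H2].
  split; apply Derive_correct; assumption.
Qed.

Lemma Csmooth_partials Sigma f z :
  Csmooth Sigma f -> Sigma z -> Chas_partials f z (Cdu f z) (Cdv f z).
Proof.
  intros [H1 H2] Hz. split.
  - exact (class_C_partials _ _ _ _ (H1 1%nat) Hz).
  - exact (class_C_partials _ _ _ _ (H2 1%nat) Hz).
Qed.

(** The derivatives in [class_C] are those of a total function, so that equality on
    [Sigma] carries over to them only because [Sigma] is open. *)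
Lemma class_C_ext Sigma k : open Sigma -> forall f g,
  (forall z, Sigma z -> f z = g z) -> class_C k Sigma f -> class_C k Sigma g.
Proof.
  intros HO.
  induction k as [|k IH]; intros f g E Hf.
  - split; [|exact I]. intros z Hz.
    refine (continuous_ext_loc _ f z _ (proj1 Hf z Hz)).
    now apply (locally_ext_of_open Sigma).
  - destruct Hf as (Hc & Hd & Hu & Hv). split; [|split; [|split]].
    + intros z Hz. refine (continuous_ext_loc _ f z _ (Hc z Hz)).
      now apply (locally_ext_of_open Sigma).
    + intros z Hz. destruct (Hd z Hz) as [H1 H2].
      assert (L := locally_ext_of_open _ _ _ _ HO E Hz).
      split.
      * exact (ex_derive_ext_loc _ _ _ (locally_horizontal _ _ L) H1).
      * exact (ex_derive_ext_loc _ _ _ (locally_vertical _ _ L) H2).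
    + refine (IH _ _ _ Hu). intros z Hz. apply du_ext_loc.
      now apply (locally_ext_of_open Sigma).
    + refine (IH _ _ _ Hv). intros z Hz. apply dv_ext_loc.
      now apply (locally_ext_of_open Sigma).
Qed.

Lemma class_C_pred Sigma k : forall f, class_C (S k) Sigma f -> class_C k Sigma f.
Proof.
  induction k as [|k IH]; intros f (Hc & Hd & Hu & Hv).
  - split; [exact Hc | exact I].
  - split; [exact Hc | split; [exact Hd | split]]; apply IH; assumption.
Qed.

(** The induction step shared by the closure properties below. *)
Lemma class_C_of_partials Sigma k f a b : open Sigma ->
  (forall z, Sigma z -> continuous f z) ->
  (forall z, Sigma z -> has_partials f z (a z) (b z)) ->
  class_C k Sigma a -> class_C k Sigma b -> class_C (S k) Sigma f.
Proof.
  intros HO Hc Hp Ha Hb. split; [exact Hc|split; [|split]].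
  - intros z Hz. destruct (Hp z Hz) as [H1 H2]. split; eexists; eassumption.
  - refine (class_C_ext _ _ HO _ _ _ Ha). intros z Hz. symmetry.
    exact (has_partials_du _ _ _ _ (Hp z Hz)).
  - refine (class_C_ext _ _ HO _ _ _ Hb). intros z Hz. symmetry.
    exact (has_partials_dv _ _ _ _ (Hp z Hz)).
Qed.

Lemma class_C_const Sigma k (c : R) : open Sigma -> class_C k Sigma (fun _ => c).
Proof.
  intros HO. revert c. induction k as [|k IH]; intros c.
  - split; [|exact I]. intros; apply continuous_const.
  - apply (class_C_of_partials _ _ _ (fun _ => 0) (fun _ => 0)); auto.
    + intros; apply continuous_const.
    + intros z Hz; split; exact (is_derive_const _ _).
Qed.

Lemma class_C_plus Sigma k f g : open Sigma ->
  class_C k Sigma f -> class_C k Sigma g -> class_C k Sigma (fun w => f w + g w).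
Proof.
  intros HO. revert f g. induction k as [|k IH]; intros f g Hf Hg.
  - split; [|exact I]. intros z Hz.
    exact (continuous_plus _ _ _ (proj1 Hf z Hz) (proj1 Hg z Hz)).
  - apply (class_C_of_partials _ _ _ (fun w => du f w + du g w)
             (fun w => dv f w + dv g w)); auto.
    + intros z Hz.
      exact (continuous_plus _ _ _ (proj1 Hf z Hz) (proj1 Hg z Hz)).
    + intros z Hz. apply has_partials_plus; eapply class_C_partials; eassumption.
    + apply IH; [apply Hf | apply Hg].
    + apply IH; [apply Hf | apply Hg].
Qed.

Lemma class_C_mult Sigma k f g : open Sigma ->
  class_C k Sigma f -> class_C k Sigma g -> class_C k Sigma (fun w => f w * g w).
Proof.
  intros HO. revert f g. induction k as [|k IH]; intros f g Hf Hg.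
  - split; [|exact I]. intros z Hz.
    exact (continuous_mult _ _ _ (proj1 Hf z Hz) (proj1 Hg z Hz)).
  - apply (class_C_of_partials _ _ _ (fun w => du f w * g w + f w * du g w)
             (fun w => dv f w * g w + f w * dv g w)); auto.
    + intros z Hz.
      exact (continuous_mult _ _ _ (proj1 Hf z Hz) (proj1 Hg z Hz)).
    + intros z Hz. apply has_partials_mult; eapply class_C_partials; eassumption.
    + apply class_C_plus; trivial; apply IH;
        first [apply Hf | apply Hg | now apply class_C_pred].
    + apply class_C_plus; trivial; apply IH;
        first [apply Hf | apply Hg | now apply class_C_pred].
Qed.

Lemma class_C_exp Sigma k f : open Sigma ->
  class_C k Sigma f -> class_C k Sigma (fun w => exp (f w)).
Proof.
  intros HO. revert f. induction k as [|k IH]; intros f Hf.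
  - split; [|exact I]. intros z Hz.
    exact (continuous_comp f exp z (proj1 Hf z Hz) (continuous_exp _)).
  - apply (class_C_of_partials _ _ _ (fun w => du f w * exp (f w))
             (fun w => dv f w * exp (f w))); auto.
    + intros z Hz.
      exact (continuous_comp f exp z (proj1 Hf z Hz) (continuous_exp _)).
    + intros z Hz. apply has_partials_exp; eapply class_C_partials; eassumption.
    + apply class_C_mult; [trivial | apply Hf | apply IH; now apply class_C_pred].
    + apply class_C_mult; [trivial | apply Hf | apply IH; now apply class_C_pred].
Qed.

Lemma mixed_partials_commute Sigma f z : open Sigma ->
  class_C 2 Sigma f -> Sigma z -> du (dv f) z = dv (du f) z.
Proof.
  intros HO Hf Hz. destruct z as [u v].
  apply (Schwarz (fun a b => f (a, b)) u v).
  - apply (proj2 (locally_2d_locally _ u v)).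
    generalize (HO _ Hz). apply filter_imp. intros [a b] Hab. simpl.
    destruct Hf as (_ & H1 & (_ & H2 & _) & (_ & H3 & _)).
    destruct (H1 _ Hab), (H2 _ Hab), (H3 _ Hab). now repeat split.
  - apply continuity_2d_pt_filterlim.
    destruct Hf as (_ & _ & _ & (_ & _ & (H & _) & _)).
    refine (continuous_ext (du (dv f)) _ (u, v) _ (H _ Hz)). now intros [a b].
  - apply continuity_2d_pt_filterlim.
    destruct Hf as (_ & _ & (_ & _ & _ & (H & _)) & _).
    refine (continuous_ext (dv (du f)) _ (u, v) _ (H _ Hz)). now intros [a b].
Qed.

(** Existence of the partial derivatives alone does not give differentiability;
    their continuity does. *)
Lemma C1_filterdiff Sigma f z : open Sigma -> class_C 1 Sigma f -> Sigma z ->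
  filterdiff (U := C_R_NormedModule) (V := R_NormedModule) f (locally z)
    (fun h => fst h * du f z + snd h * dv f z).
Proof.
  intros HO Hf Hz. destruct z as [u v].
  assert (D := is_derive_filterdiff (fun a b => f (a, b)) u v
    (fun a b => du f (a, b)) (dv f (u, v))).
  refine (filterdiff_ext _ _ _ _ (D _ _ _)).
  - now intros [a b].
  - generalize (HO _ Hz). apply filter_imp. intros [a b] Hab.
    exact (proj1 (class_C_partials _ _ _ _ Hf Hab)).
  - exact (proj2 (class_C_partials _ _ _ _ Hf Hz)).
  - destruct Hf as (_ & _ & (H & _) & _).
    refine (continuous_ext (du f) _ (u, v) _ (H _ Hz)). now intros [a b].
Qed.

(** * Holomorphic functions *)

Lemma Cmod_le_sum (c : C) : Cmod c <= Rabs (Re c) + Rabs (Im c).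
Proof.
  destruct c as [a b]. unfold Re, Im; simpl fst; simpl snd.
  replace (a, b) with (RtoC a + Ci * RtoC b)%C
    by (unfold RtoC, Ci, Cplus, Cmult; simpl; f_equal; ring).
  eapply Rle_trans; [apply Cmod_triangle|].
  rewrite Cmod_mult, !Cmod_R.
  replace (Cmod Ci) with 1; [lra|].
  unfold Cmod, Ci; simpl. replace (0 * (0 * 1) + 1 * (1 * 1)) with 1 by ring.
  now rewrite sqrt_1.
Qed.

Lemma im_le_Cmod (c : C) : Rabs (Im c) <= Cmod c.
Proof. eapply Rle_trans; [apply Rmax_r|apply Rmax_Cmod]. Qed.

(** Real differentiability is expressed with the product norm of R x R, complex
    differentiability with the modulus. *)
Lemma norm_pair_Cmod (c : C) : @norm R_AbsRing C_R_NormedModule c = Cmod c.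
Proof.
  destruct c as [a b]. unfold norm; simpl. unfold prod_norm, Cmod; simpl.
  f_equal. unfold norm; simpl. unfold abs; simpl.
  generalize (pow2_abs a) (pow2_abs b); simpl. intros -> ->. reflexivity.
Qed.

Lemma filterdiff_bound (f : C -> R) (z : C) (l : C -> R) :
  filterdiff (U := C_R_NormedModule) (V := R_NormedModule) f (locally z) l ->
  forall eps : posreal, locally z (fun w =>
    Rabs (f w - f z - l (w - z)%C) <= eps * Cmod (w - z)%C).
Proof.
  intros [_ H] eps.
  generalize (H z (fun P HP => HP) eps). apply filter_imp. intros w Hw.
  rewrite norm_pair_Cmod in Hw. exact Hw.
Qed.

(** Continuity of the partial derivatives makes the real and imaginary parts
    differentiable as functions of two real variables; under the Cauchy-Riemann
    equations the two real-linear differentials assemble into multiplication by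
    the complex number [Cdu f z]. *)
Lemma holomorphic_of_Cauchy_Riemann Sigma f : open Sigma ->
  class_C 1 Sigma (fun w => Re (f w)) -> class_C 1 Sigma (fun w => Im (f w)) ->
  (forall z, Sigma z ->
     Cdv f z = (Ci * Cdu f z)%C) ->
  holomorphic Sigma f.
Proof.
  intros HO Hr Hi HCR z Hz. exists (Cdu f z). split.
  { apply is_linear_scal_l. }
  intros z' Hz' eps.
  rewrite <- (is_filter_lim_locally_unique _ _ Hz'). clear z' Hz'.
  apply locally_C.
  assert (Hr' := filterdiff_bound _ _ _ (C1_filterdiff _ _ _ HO Hr Hz)
    (pos_div_2 eps)).
  assert (Hi' := filterdiff_bound _ _ _ (C1_filterdiff _ _ _ HO Hi Hz)
    (pos_div_2 eps)).
  generalize (filter_and _ _ Hr' Hi'). apply filter_imp.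
  intros w [H1 H2].
  change (Cmod ((f w - f z) - (w - z) * Cdu f z)%C <= eps * Cmod (w - z)%C).
  eapply Rle_trans; [apply Cmod_le_sum|].
  specialize (HCR z Hz).
  assert (E1 := f_equal fst HCR). assert (E2 := f_equal snd HCR).
  simpl in E1, E2.
  rewrite E1 in H1. rewrite E2 in H2.
  simpl in H1, H2. unfold Re, Im in *; simpl in *.
  unfold Re, Im in *.
  match type of H1 with Rabs ?a <= _ => match goal with |- Rabs ?b + _ <= _ =>
    replace b with a by ring end end.
  match type of H2 with Rabs ?a <= _ => match goal with |- _ + Rabs ?b <= _ =>
    replace b with a by ring end end.
  lra.
Qed.

Lemma Cmod_imaginary (t : R) : Cmod (0, t) = Rabs t.
Proof.
  unfold Cmod; simpl. replace (0 * (0 * 1) + t * (t * 1)) with (Rsqr t)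
    by (unfold Rsqr; ring).
  apply sqrt_Rsqr_abs.
Qed.

(** The first order expansion of [p] is bounded by the complex modulus, which on
    horizontal and vertical increments is the real absolute value. *)
Lemma has_partials_of_bound (p : C -> R) (z : C) (a b : R) :
  (forall eps : posreal, locally z (fun w =>
     Rabs (p w - p z - (fst (w - z)%C * a + snd (w - z)%C * b))
       <= eps * Cmod (w - z)%C)) ->
  has_partials p z a b.
Proof.
  destruct z as [u v]. intros B.
  split; (split; [apply is_linear_scal_l|]); intros t' Ht' eps;
    rewrite <- (is_filter_lim_locally_unique _ _ Ht'); clear t' Ht'.
  - generalize (locally_horizontal _ _ (B eps)). apply filter_imp. intros t.
    replace ((t, snd (u, v)) - (u, v))%C with (t - u, 0)
      by (unfold Cminus, Cplus, Copp; simpl; f_equal; ring).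
    change (Cmod (t - u, 0)) with (Cmod (RtoC (t - u))). rewrite Cmod_R. simpl.
    intros Ht. eapply Rle_trans; [|exact Ht]. right.
    unfold norm, minus, plus, opp, scal; simpl.
    unfold abs; simpl. f_equal. unfold mult; simpl. ring.
  - generalize (locally_vertical _ _ (B eps)). apply filter_imp. intros t.
    replace ((fst (u, v), t) - (u, v))%C with (0, t - v)
      by (unfold Cminus, Cplus, Copp; simpl; f_equal; ring).
    rewrite Cmod_imaginary. simpl.
    intros Ht. eapply Rle_trans; [|exact Ht]. right.
    unfold norm, minus, plus, opp, scal; simpl.
    unfold abs; simpl. f_equal. unfold mult; simpl. ring.
Qed.

(** Cauchy-Riemann: the derivatives along 1 and i of a complex differentiable
    function are l and i l. *)
Lemma holomorphic_partials Sigma f z : holomorphic Sigma f -> Sigma z ->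
  exists l, Chas_partials f z l (Ci * l)%C.
Proof.
  intros Hf Hz. destruct (Hf z Hz) as [l [_ H]]. exists l.
  assert (B : forall eps : posreal, locally z (fun w =>
    Cmod (f w - f z - (w - z) * l)%C <= eps * Cmod (w - z)%C)).
  { intros eps. apply locally_C. exact (H z (fun P HP => HP) eps). }
  split; apply has_partials_of_bound; intros eps;
    generalize (B eps); apply filter_imp; intros w Hw;
    (eapply Rle_trans; [|exact Hw]).
  - eapply Rle_trans; [|apply re_le_Cmod]. right. f_equal.
    unfold Re; simpl. ring.
  - eapply Rle_trans; [|apply im_le_Cmod]. right. f_equal.
    unfold Im; simpl. ring.
Qed.

Lemma Cmult_continuous {T : UniformSpace} (f g : T -> C) t :
  continuous (U := C_UniformSpace) f t -> continuous (U := C_UniformSpace) g t ->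
  continuous (U := C_UniformSpace) (fun s => (f s * g s)%C) t.
Proof.
  intros Hf Hg.
  assert (F1 : continuous (fun s => fst (f s)) t).
  { refine (continuous_comp f fst t Hf _). destruct (f t). apply continuous_fst. }
  assert (F2 : continuous (fun s => snd (f s)) t).
  { refine (continuous_comp f snd t Hf _). destruct (f t). apply continuous_snd. }
  assert (G1 : continuous (fun s => fst (g s)) t).
  { refine (continuous_comp g fst t Hg _). destruct (g t). apply continuous_fst. }
  assert (G2 : continuous (fun s => snd (g s)) t).
  { refine (continuous_comp g snd t Hg _). destruct (g t). apply continuous_snd. }
  refine (continuous_comp_2 (fun s => fst (f s) * fst (g s) - snd (f s) * snd (g s))
     (fun s => fst (f s) * snd (g s) + snd (f s) * fst (g s))
     (fun a b => (a, b)) t _ _ _).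
  - apply (continuous_minus (V := R_NormedModule));
      now apply (continuous_mult (K := R_AbsRing)).
  - apply (continuous_plus (V := R_NormedModule));
      now apply (continuous_mult (K := R_AbsRing)).
  - apply continuous_ext with (fun x => x); [now intros []|]. apply continuous_id.
Qed.

Lemma holomorphic_continuous Sigma f z :
  holomorphic Sigma f -> Sigma z -> continuous (U := C_UniformSpace) f z.
Proof.
  intros Hf Hz. generalize (ex_derive_continuous _ _ (Hf z Hz)).
  intros H P HP. apply locally_C. apply H. exact HP.
Qed.

(** * Integration along paths *)

Lemma derive_along_path Sigma p g dg t : open Sigma -> class_C 1 Sigma p ->
  C1_path Sigma g dg -> unit_interval t ->
  is_derive (fun s => p (g s)) t
    (fst (dg t) * du p (g t) + snd (dg t) * dv p (g t)).
Proof.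
  intros HO Hp Hg Ht. destruct (Hg t Ht) as (Hz & Hd & _).
  assert (D := filterdiff_comp' (U := R_NormedModule) (V := C_R_NormedModule)
    (W := R_NormedModule) g p t _ _ Hd (C1_filterdiff _ _ _ HO Hp Hz)).
  refine (filterdiff_ext_lin _ _ _ D _).
  intros y. unfold scal; simpl. unfold scal; simpl. unfold mult; simpl. ring.
Qed.

Lemma is_RInt_Re_path_integral (Sigma : C -> Prop) f g dg :
  (forall z, Sigma z -> continuous (U := C_UniformSpace) f z) ->
  C1_path Sigma g dg ->
  is_RInt (fun t => Re (f (g t) * dg t)%C) 0 1 (Re (path_integral f g dg)).
Proof.
  intros Hf Hg.
  refine (is_RInt_fct_extend_fst (U := R_NormedModule) (V := R_NormedModule)
     _ _ _ _ (RInt_correct (V := C_R_CompleteNormedModule) _ _ _ _)).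
  apply (ex_RInt_continuous (V := C_R_CompleteNormedModule)).
  intros t Ht. rewrite Rmin_left, Rmax_right in Ht by lra.
  destruct (Hg t Ht) as (Hz & Hd & Hc).
  apply Cmult_continuous; [|exact Hc].
  refine (continuous_comp g f t _ (Hf _ Hz)).
  apply (ex_derive_continuous (V := C_R_NormedModule)). now exists (dg t).
Qed.

(** The chain rule gives (p o g)' = Re (f(g) g'), so this is the fundamental
    theorem of calculus for p o g. *)
Lemma path_integral_of_gradient Sigma p f g dg : open Sigma ->
  (forall z, Sigma z -> continuous (U := C_UniformSpace) f z) ->
  class_C 1 Sigma p ->
  (forall z, Sigma z -> du p z = Re (f z)) ->
  (forall z, Sigma z -> dv p z = - Im (f z)) ->
  C1_path Sigma g dg ->
  p (g 1) = p (g 0) + Re (path_integral f g dg).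
Proof.
  intros HO Hf Hp Hu Hv Hg.
  assert (I01 : forall t, Rmin 0 1 <= t <= Rmax 0 1 -> unit_interval t).
  { intros t. now rewrite Rmin_left, Rmax_right by lra. }
  assert (HC : forall t, unit_interval t ->
    continuous (U := C_UniformSpace) (fun s => (f (g s) * dg s)%C) t).
  { intros t Ht. destruct (Hg t Ht) as (Hz & Hd & Hc).
    apply Cmult_continuous; [|exact Hc].
    refine (continuous_comp g f t _ (Hf _ Hz)).
    apply (ex_derive_continuous (V := C_R_NormedModule)). now exists (dg t). }
  assert (I1 := is_RInt_Re_path_integral Sigma f g dg Hf Hg).
  assert (I2 : is_RInt (fun t => Re (f (g t) * dg t)%C) 0 1 (minus (p (g 1)) (p (g 0)))).
  { apply (is_RInt_derive (V := R_CompleteNormedModule) (fun t => p (g t))).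
    - intros t Ht. apply I01 in Ht.
      assert (Hz := proj1 (Hg t Ht)).
      refine (eq_rect _ (is_derive _ _) (derive_along_path _ _ _ _ _ HO Hp Hg Ht) _ _).
      rewrite Hu, Hv by assumption. unfold Re, Im; simpl. ring.
    - intros t Ht. refine (continuous_comp _ fst t (HC t (I01 t Ht)) _).
      destruct (f (g t) * dg t)%C. apply continuous_fst. }
  apply (is_RInt_unique (V := R_CompleteNormedModule)) in I1.
  apply (is_RInt_unique (V := R_CompleteNormedModule)) in I2.
  rewrite I1 in I2. rewrite I2.
  unfold minus, plus, opp; simpl. ring.
Qed.

(** Integrating along the segment from [z] to [z + s c] and substituting in the
    integral turns it into the integral over [0, s] of one fixed continuous
    function, which can be differentiated in its upper bound. *)
Lemma is_derive_along_segment Sigma p f z (c : C) : open Sigma ->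
  (forall z, Sigma z -> continuous (U := C_UniformSpace) f z) ->
  (forall g dg, C1_path Sigma g dg ->
     p (g 1) = p (g 0) + Re (path_integral f g dg)) ->
  Sigma z ->
  Rabs (fst c) <= 1 -> Rabs (snd c) <= 1 ->
  is_derive (fun s => p (fst z + s * fst c, snd z + s * snd c)) 0 (Re (f z * c)%C).
Proof.
  intros HO Hf Hp Hz Hc1 Hc2.
  set (seg := fun s => (fst z + s * fst c, snd z + s * snd c) : C).
  assert (Hseg : forall s, is_derive (V := C_R_NormedModule) seg s c).
  { intros s.
    assert (E : is_derive (V := C_R_NormedModule)
       (fun s : R => plus (z : C_R_NormedModule) (scal s (c : C_R_NormedModule))) s
       (plus zero (scal one (c : C_R_NormedModule)))).
    { apply @is_derive_plus; [apply @is_derive_const|].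
      apply @is_derive_scal_l. apply @is_derive_id. }
    rewrite plus_zero_l, (scal_one (c : C_R_NormedModule)) in E. exact E. }
  destruct (HO z Hz) as [e He].
  (* The ball around z is a square, which is why the components of c are bounded. *)
  assert (Hin : forall s, Rabs s < e -> Sigma (seg s)).
  { intros s Hs. apply He.
    assert (B : forall a d, Rabs d <= 1 -> Rabs (a + s * d + - a) < e).
    { intros a d Hd. replace (a + s * d + - a) with (s * d) by ring.
      rewrite Rabs_mult. generalize (Rabs_pos s) (Rabs_pos d). nra. }
    split; apply B; assumption. }
  set (phi := fun s => Re (f (seg s) * c)%C).
  assert (Hphi : forall s, Rabs s < e -> continuous phi s).
  { intros s Hs.
    refine (continuous_comp (fun s => (f (seg s) * c)%C) fst s _ _).
    - apply Cmult_continuous; [|apply continuous_const].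
      refine (continuous_comp seg f s _ (Hf _ (Hin s Hs))).
      apply (ex_derive_continuous (V := C_R_NormedModule)). now exists c.
    - destruct (f (seg s) * c)%C. apply continuous_fst. }
  assert (Hint : forall s, Rabs s < e -> ex_RInt phi 0 s).
  { intros s Hs. apply (ex_RInt_continuous (V := R_CompleteNormedModule)).
    intros t Ht. apply Hphi. revert Ht Hs. unfold Rmin, Rmax, Rabs.
    destruct (Rle_dec 0 s); repeat destruct Rcase_abs; lra. }
  assert (Hval : forall s, Rabs s < e -> p (seg s) = p (seg 0) + RInt phi 0 s).
  { intros s Hs.
    set (g := fun t => seg (s * t)).
    set (dg := fun _ : R => (s * c)%C).
    assert (Hg : C1_path Sigma g dg).
    { intros t [Ht0 Ht1]. split; [|split].
      - apply Hin. rewrite Rabs_mult, (Rabs_pos_eq t) by assumption.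
        generalize (Rabs_pos s). nra.
      - assert (Q : is_derive (fun t : R => s * t) t s).
        { refine (eq_rect _ (is_derive _ _)
            (is_derive_scal (fun t => t) t s one (is_derive_id t)) _ _).
          apply Rmult_1_r. }
        assert (E := is_derive_comp (V := C_R_NormedModule) seg (fun t => s * t) t _ _
          (Hseg (s * t)) Q).
        refine (eq_rect _ (is_derive g t) E _ _).
        destruct c as [c1 c2]; unfold dg, scal; simpl. unfold prod_scal, scal; simpl.
        unfold Cmult, mult; simpl. f_equal; ring.
      - apply continuous_const. }
    assert (Hp' := Hp g dg Hg). unfold g in Hp' at 1 2.
    rewrite Rmult_1_r, Rmult_0_r in Hp'. rewrite Hp'.
    assert (I1 := is_RInt_Re_path_integral Sigma f g dg Hf Hg).
    assert (I2 : is_RInt (fun t => scal s (phi (s * t + 0))) 0 1 (RInt phi 0 s)).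
    { apply (is_RInt_comp_lin (V := R_NormedModule)).
      rewrite Rmult_0_r, Rmult_1_r, !Rplus_0_r.
      apply (RInt_correct (V := R_CompleteNormedModule)), Hint, Hs. }
    apply (is_RInt_unique (V := R_CompleteNormedModule)) in I1.
    apply (is_RInt_unique (V := R_CompleteNormedModule)) in I2.
    rewrite <- I2.
    assert (E : RInt (fun t => scal s (phi (s * t + 0))) 0 1 =
                RInt (fun t => Re (f (g t) * dg t)%C) 0 1).
    { apply RInt_ext. intros t _. rewrite Rplus_0_r. unfold phi, g, dg, scal, Re; simpl.
      unfold mult; simpl. ring. }
    now rewrite E, I1. }
  assert (F : is_derive (fun s => RInt phi 0 s) 0 (phi 0)).
  { apply is_derive_RInt with 0.
    - exists e. intros s Hs. apply (RInt_correct (V := R_CompleteNormedModule)), Hint.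
      assert (Hs' : Rabs (s + - 0) < e) by exact Hs.
      now rewrite Ropp_0, Rplus_0_r in Hs'.
    - apply Hphi. rewrite Rabs_R0. apply e. }
  assert (Z : seg 0 = z).
  { unfold seg. destruct z. simpl. f_equal; ring. }
  assert (F' : is_derive (fun s => plus (RInt phi 0 s) (p z)) 0 (plus (phi 0) zero)).
  { apply @is_derive_plus; [exact F|apply @is_derive_const]. }
  rewrite plus_zero_r in F'. unfold phi in F' at 2. rewrite Z in F'.
  refine (is_derive_ext_loc _ _ _ _ _ F').
  exists e. intros s Hs.
  assert (Hs' : Rabs (s + - 0) < e) by exact Hs.
  rewrite Ropp_0, Rplus_0_r in Hs'.
  change (RInt phi 0 s + p z = p (seg s)).
  rewrite (Hval s Hs'), Z. ring.
Qed.

Lemma is_derive_recenter (h : R -> R) a l :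
  is_derive h 0 l -> is_derive (fun u => h (u + - a)) a l.
Proof.
  intros Hh.
  assert (Q : is_derive (fun u : R => u + - a) a (plus one zero)).
  { apply @is_derive_plus; [apply @is_derive_id|apply @is_derive_const]. }
  rewrite plus_zero_r in Q.
  assert (Hh' : is_derive h (a + - a) l) by now rewrite Rplus_opp_r.
  refine (eq_rect _ (is_derive _ _) (is_derive_comp h _ a _ _ Hh' Q) _ _).
  apply scal_one.
Qed.

(** Unlike [path_integral_of_gradient], which takes the differentiability of [p] as
    given, this derives it from the integral formula. *)
Lemma gradient_of_path_integral Sigma p f z : open Sigma ->
  (forall z, Sigma z -> continuous (U := C_UniformSpace) f z) ->
  (forall g dg, C1_path Sigma g dg ->
     p (g 1) = p (g 0) + Re (path_integral f g dg)) ->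
  Sigma z ->
  has_partials p z (Re (f z)) (- Im (f z)).
Proof.
  intros HO Hf Hp Hz.
  assert (D := fun c => is_derive_along_segment Sigma p f z c HO Hf Hp Hz).
  destruct z as [u v]. split.
  - assert (D1 := D (RtoC 1)). simpl in D1. rewrite Rabs_R1, Rabs_R0 in D1.
    assert (D2 := is_derive_recenter _ u _ (D1 ltac:(lra) ltac:(lra))).
    refine (eq_rect _ (is_derive _ _) (is_derive_ext _ _ _ _ _ D2) _ _).
    + intros t; simpl. f_equal. f_equal; ring.
    + unfold Re; simpl. ring.
  - assert (D1 := D Ci). simpl in D1. rewrite Rabs_R1, Rabs_R0 in D1.
    assert (D2 := is_derive_recenter _ v _ (D1 ltac:(lra) ltac:(lra))).
    refine (eq_rect _ (is_derive _ _) (is_derive_ext _ _ _ _ _ D2) _ _).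
    + intros t; simpl. f_equal. f_equal; ring.
    + unfold Re, Im; simpl. ring.
Qed.

(** * Elementary facts on complex numbers and smooth functions *)

Lemma C_eq (a b : C) : Re a = Re b -> Im a = Im b -> a = b.
Proof. destruct a, b; unfold Re, Im; simpl; congruence. Qed.

Lemma Cmod_sqr (c : C) : Cmod c ^ 2 = Re c ^ 2 + Im c ^ 2.
Proof.
  unfold Cmod, Re, Im. apply pow2_sqrt.
  generalize (pow2_ge_0 (fst c)) (pow2_ge_0 (snd c)). lra.
Qed.

Lemma class_C_opp Sigma k f : open Sigma ->
  class_C k Sigma f -> class_C k Sigma (fun w => - f w).
Proof.
  intros HO Hf. apply (class_C_ext Sigma k HO (fun w => (-1) * f w)).
  - intros; ring.
  - apply class_C_mult; [trivial| |trivial]. now apply class_C_const.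
Qed.

Lemma Csmooth_continuous Sigma f z :
  Csmooth Sigma f -> Sigma z -> continuous (U := C_UniformSpace) f z.
Proof.
  intros [H1 H2] Hz.
  apply (continuous_ext (U := C_UniformSpace) (fun w => (Re (f w), Im (f w)))).
  { intros w. now destruct (f w). }
  refine (continuous_comp_2 _ _ (fun a b => (a, b)) z
    (class_C_continuous _ _ _ (H1 O) z Hz) (class_C_continuous _ _ _ (H2 O) z Hz) _).
  apply continuous_ext with (fun x => x); [now intros []|]. apply continuous_id.
Qed.

(** * Wirtinger derivatives *)

Lemma d_zbar_of_partials f z a b :
  Chas_partials f z a b -> d_zbar f z = (/ 2 * (a + Ci * b))%C.
Proof.
  intros H. unfold d_zbar.
  now rewrite (Chas_partials_Cdu _ _ _ _ H), (Chas_partials_Cdv _ _ _ _ H).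
Qed.

Lemma d_zbar_mult f g z a b c d :
  Chas_partials f z a b -> Chas_partials g z c d ->
  d_zbar (fun w => f w * g w)%C z = (d_zbar f z * g z + f z * d_zbar g z)%C.
Proof.
  intros Hf Hg.
  rewrite (d_zbar_of_partials _ _ _ _ (Chas_partials_mult _ _ _ _ _ _ _ Hf Hg)).
  rewrite (d_zbar_of_partials _ _ _ _ Hf), (d_zbar_of_partials _ _ _ _ Hg). ring.
Qed.

Lemma d_zbar_scal (k : C) f z a b :
  Chas_partials f z a b -> d_zbar (fun w => k * f w)%C z = (k * d_zbar f z)%C.
Proof.
  intros Hf.
  assert (Hk : Chas_partials (fun _ => k) z 0 0)
    by (split; split; exact (is_derive_const _ _)).
  rewrite (d_zbar_mult _ _ _ _ _ _ _ Hk Hf), (d_zbar_of_partials _ _ _ _ Hk). ring.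
Qed.

Lemma d_zbar_ext_loc (f g : C -> C) (z : C) :
  locally z (fun w : C => f w = g w) -> d_zbar f z = d_zbar g z.
Proof.
  intros E. unfold d_zbar, Cdu, Cdv.
  assert (E1 : locally z (fun w : C => Re (f w) = Re (g w)))
    by (revert E; apply filter_imp; now intros w ->).
  assert (E2 : locally z (fun w : C => Im (f w) = Im (g w)))
    by (revert E; apply filter_imp; now intros w ->).
  now rewrite (du_ext_loc _ _ _ E1), (du_ext_loc _ _ _ E2),
    (dv_ext_loc _ _ _ E1), (dv_ext_loc _ _ _ E2).
Qed.

Lemma d_zbar_holomorphic Sigma f z : holomorphic Sigma f -> Sigma z -> d_zbar f z = 0%C.
Proof.
  intros Hf Hz. destruct (holomorphic_partials _ _ _ Hf Hz) as [l Hl].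
  rewrite (d_zbar_of_partials _ _ _ _ Hl).
  apply C_eq; unfold Re, Im; simpl; field.
Qed.

(** The equation f_u + i f_v = 0 is the Cauchy-Riemann equation f_v = i f_u. *)
Lemma holomorphic_of_d_zbar Sigma f : open Sigma -> Csmooth Sigma f ->
  (forall z, Sigma z -> d_zbar f z = 0%C) -> holomorphic Sigma f.
Proof.
  intros HO [H1 H2] H.
  apply holomorphic_of_Cauchy_Riemann; [exact HO | apply H1 | apply H2 |].
  intros z Hz. specialize (H z Hz). unfold d_zbar in H.
  destruct (Cdu f z) as [a b], (Cdv f z) as [c d].
  assert (E1 := f_equal Re H). assert (E2 := f_equal Im H).
  unfold Re, Im in E1, E2; simpl in E1, E2.
  apply C_eq; unfold Re, Im; simpl; lra.
Qed.

Lemma d_z_conj f z : d_z (fun w => Cconj (f w)) z = Cconj (d_zbar f z).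
Proof.
  assert (Eu : du (fun w => Im (Cconj (f w))) z = - du (fun w => Im (f w)) z)
    by apply Derive_opp.
  assert (Ev : dv (fun w => Im (Cconj (f w))) z = - dv (fun w => Im (f w)) z)
    by apply Derive_opp.
  unfold d_z, d_zbar, Cdu, Cdv. rewrite Eu, Ev.
  apply C_eq; unfold Re, Im; simpl; field.
Qed.

(** * Real parts of primitives *)

(** This is the equation dp = Re (f dz), that is, p = Re (integral of f dz) up to a
    constant; the sign comes from Re (f i) = - Im f. *)
Definition re_primitive (Sigma : C -> Prop) (p : C -> R) (f : C -> C) : Prop :=
  forall z, Sigma z -> du p z = Re (f z) /\ dv p z = - Im (f z).

(** Twice f_zbar is the Laplacian of [p]: the imaginary part of f_zbar is a
    difference of mixed second derivatives of [p]. *)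
Lemma Im_d_zbar_re_primitive Sigma p f z : open Sigma ->
  class_C 2 Sigma p -> re_primitive Sigma p f -> Sigma z -> Im (d_zbar f z) = 0.
Proof.
  intros HO Hp Hf Hz.
  assert (Er : locally z (fun w : C => Re (f w) = du p w)).
  { apply (locally_ext_of_open Sigma); auto. intros w Hw. symmetry. now apply Hf. }
  assert (Ei : locally z (fun w : C => Im (f w) = - dv p w)).
  { apply (locally_ext_of_open Sigma); auto. intros w Hw.
    rewrite (proj2 (Hf w Hw)). ring. }
  assert (M := mixed_partials_commute _ _ _ HO Hp Hz).
  unfold d_zbar, Cdu, Cdv.
  rewrite (dv_ext_loc _ _ _ Er), (du_ext_loc _ _ _ Ei).
  assert (Eo : du (fun w => - dv p w) z = - du (dv p) z) by apply Derive_opp.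
  rewrite Eo, M. unfold Im; simpl. field.
Qed.

Lemma d_z_re_primitive Sigma p f z : re_primitive Sigma p f -> Sigma z ->
  d_z (fun w => RtoC (p w)) z = (/ 2 * f z)%C.
Proof.
  intros Hf Hz. destruct (Hf z Hz) as [Hu Hv].
  assert (E1 : du (fun w => Im (RtoC (p w))) z = 0) by exact (Derive_const 0 _).
  assert (E2 : dv (fun w => Im (RtoC (p w))) z = 0) by exact (Derive_const 0 _).
  unfold d_z, Cdu, Cdv. rewrite E1, E2.
  change (fun w => Re (RtoC (p w))) with (fun w => p w).
  change (du (fun w => p w) z) with (du p z).
  change (dv (fun w => p w) z) with (dv p z).
  rewrite Hu, Hv.
  apply C_eq; unfold Re, Im; simpl; field.
Qed.

(** By [Im_d_zbar_re_primitive], D := d_zbar (alpha^2) has D and - i D both real,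
    hence D = 0; and D = 2 alpha d_zbar alpha, where alpha does not vanish. *)
Lemma holomorphic_sqrt_gradient Sigma p q alpha : open Sigma ->
  smooth Sigma p -> smooth Sigma q -> Csmooth Sigma alpha ->
  (forall z, Sigma z -> alpha z <> 0%C) ->
  re_primitive Sigma p (fun z => alpha z * alpha z)%C ->
  re_primitive Sigma q (fun z => - Ci * (alpha z * alpha z))%C ->
  holomorphic Sigma alpha.
Proof.
  intros HO Hp Hq Ha Hn Pp Pq.
  apply holomorphic_of_d_zbar; [exact HO | exact Ha |].
  intros z Hz.
  assert (A := Csmooth_partials _ _ _ Ha Hz).
  assert (AA := Chas_partials_mult _ _ _ _ _ _ _ A A).
  assert (E1 := Im_d_zbar_re_primitive _ _ _ _ HO (Hp 2%nat) Pp Hz).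
  assert (E2 := Im_d_zbar_re_primitive _ _ _ _ HO (Hq 2%nat) Pq Hz).
  rewrite (d_zbar_scal _ _ _ _ _ AA) in E2.
  assert (Z : d_zbar (fun z => alpha z * alpha z)%C z = 0%C).
  { apply C_eq; [|exact E1]. revert E1 E2. unfold Re, Im; simpl. lra. }
  rewrite (d_zbar_mult _ _ _ _ _ _ _ A A) in Z.
  assert (Hz0 := Hn z Hz).
  replace (d_zbar alpha z)
    with (/ (2 * alpha z) * (d_zbar alpha z * alpha z + alpha z * d_zbar alpha z))%C.
  - rewrite Z. ring.
  - field. exact Hz0.
Qed.

(** * From the adapted frame to the Weierstrass data *)

(** Written by components so that the real and imaginary parts are products of
    real functions, to which the real closure lemmas apply. *)
Definition frame_alpha (F : C -> M2) (sigma : C -> R) (z : C) : C :=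
  (exp (/ 2 * sigma z) * Re (entry (F z) 0 0),
   exp (/ 2 * sigma z) * Im (entry (F z) 0 0)).

(** This is e^(sigma/2) times the conjugate of the upper right entry. *)
Definition frame_beta (F : C -> M2) (sigma : C -> R) (z : C) : C :=
  (exp (/ 2 * sigma z) * Re (entry (F z) 0 1),
   - (exp (/ 2 * sigma z) * Im (entry (F z) 0 1))).

Lemma exp_half (s : R) : exp s = exp (/ 2 * s) * exp (/ 2 * s).
Proof. rewrite <- exp_plus. f_equal. field. Qed.

Lemma frame_Csmooth Sigma x sigma F : open Sigma -> smooth Sigma sigma ->
  adapted_frame Sigma x sigma F ->
  Csmooth Sigma (frame_alpha F sigma) /\ Csmooth Sigma (frame_beta F sigma).
Proof.
  intros HO Hs [HF _].
  assert (He : smooth Sigma (fun z => exp (/ 2 * sigma z))).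
  { intros k. apply class_C_exp; [trivial|].
    apply class_C_mult; [trivial|now apply class_C_const|apply Hs]. }
  assert (H0 := HF 0%nat 0%nat ltac:(repeat constructor) ltac:(repeat constructor)).
  assert (H1 := HF 0%nat 1%nat ltac:(repeat constructor) ltac:(repeat constructor)).
  destruct H0 as [H00 H01], H1 as [H10 H11].
  repeat split; intros k.
  - exact (class_C_mult _ _ _ _ HO (He k) (H00 k)).
  - exact (class_C_mult _ _ _ _ HO (He k) (H01 k)).
  - exact (class_C_mult _ _ _ _ HO (He k) (H10 k)).
  - exact (class_C_opp _ _ _ HO (class_C_mult _ _ _ _ HO (He k) (H11 k))).
Qed.

Lemma frame_alpha_nonzero Sigma x sigma F z :
  adapted_frame Sigma x sigma F -> Sigma z -> frame_alpha F sigma z <> 0%C.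
Proof.
  intros [_ HF] Hz E. destruct (HF z Hz) as [(theta & w & EF) _].
  assert (E1 := f_equal Re E). assert (E2 := f_equal Im E).
  unfold frame_alpha in E1, E2. rewrite EF in E1, E2.
  unfold Re, Im in E1, E2; simpl in E1, E2.
  assert (P := exp_pos (/ 2 * sigma z)).
  assert (S := sin2_cos2 theta). unfold Rsqr in S.
  apply Rmult_integral in E1, E2.
  destruct E1 as [E1|E1]; [lra|]. destruct E2 as [E2|E2]; [lra|].
  rewrite E1, E2 in S. lra.
Qed.

(** The entry (0,1) of the Hermitian form is x + i y and the entry (0,0) is 2 l. For
    F = ((a, b), (0, conj a)), the entries (0,1) of F E_1 F* and F E_2 F* are a^2
    and i a^2, and the entries (0,0) are 2 Re (b conj a) and 2 Im (b conj a). *)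
Lemma frame_gradient Sigma x sigma F : open Sigma ->
  (forall z, Sigma z -> isotropic_space (x z)) ->
  vsmooth Sigma x ->
  adapted_frame Sigma x sigma F ->
  let a := frame_alpha F sigma in let b := frame_beta F sigma in
  re_primitive Sigma (fun z => x0 (x z)) (fun z => a z * b z)%C /\
  re_primitive Sigma (fun z => x1 (x z)) (fun z => a z * a z)%C /\
  re_primitive Sigma (fun z => x2 (x z)) (fun z => - Ci * (a z * a z))%C /\
  re_primitive Sigma (fun z => x3 (x z)) (fun z => a z * b z)%C.
Proof.
  intros HO Hiso (S0 & S1 & S2 & S3) [_ HF] a b.
  (* With g = a^2, - Ci * g has real part Im g and imaginary part - Re g. *)
  assert (X : forall z, Sigma z ->
    let f := (a z * b z)%C in let g := (a z * a z)%C in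
    (du (fun w => x0 (x w)) z = Re f /\ dv (fun w => x0 (x w)) z = - Im f) /\
    (du (fun w => x1 (x w)) z = Re g /\ dv (fun w => x1 (x w)) z = - Im g) /\
    (du (fun w => x2 (x w)) z = Im g /\ dv (fun w => x2 (x w)) z = Re g) /\
    (du (fun w => x3 (x w)) z = Re f /\ dv (fun w => x3 (x w)) z = - Im f)).
  2:{ repeat apply conj; intros z Hz;
        destruct (X z Hz) as (D0 & D1 & (U2 & V2) & D3); trivial.
      rewrite U2, V2. split; unfold Re, Im; simpl; ring. }
  intros z Hz f g.
  destruct (HF z Hz) as [(theta & w & EF) [HU HV]].
  (* In isotropic space the outer coordinates agree: both are l. *)
  assert (L03 : locally z (fun w : C => x3 (x w) = x0 (x w))).
  { apply (locally_ext_of_open Sigma); auto. intros y Hy.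
    generalize (Hiso y Hy). unfold isotropic_space, lorentz, pp; simpl. lra. }
  rewrite (du_ext_loc _ _ _ L03), (dv_ext_loc _ _ _ L03).
  assert (P0 := class_C_partials _ _ _ _ (S0 1%nat) Hz).
  assert (P1 := class_C_partials _ _ _ _ (S1 1%nat) Hz).
  assert (P2 := class_C_partials _ _ _ _ (S2 1%nat) Hz).
  assert (P00 : Chas_partials (fun w => RtoC (x0 (x w) + x3 (x w))) z
    (RtoC (2 * du (fun w => x0 (x w)) z)) (RtoC (2 * dv (fun w => x0 (x w)) z))).
  { split; [|split; exact (is_derive_const _ _)].
    refine (has_partials_ext_loc _ _ _ _ _ _ (has_partials_eq _ _ _ _ _ _
      (has_partials_plus _ _ _ _ _ _ _ P0 P0) _ _)).
    - revert L03. apply filter_imp. intros y Hy. unfold Re; simpl. now rewrite Hy.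
    - unfold Re; simpl; ring.
    - unfold Re; simpl; ring. }
  assert (P01 : Chas_partials (fun w => x1 (x w) + Ci * x2 (x w))%C z
    (du (fun w => x1 (x w)) z, du (fun w => x2 (x w)) z)
    (dv (fun w => x1 (x w)) z, dv (fun w => x2 (x w)) z)).
  { split.
    - refine (has_partials_ext_loc _ _ _ _ _ _ P1).
      apply filter_forall. intros y. unfold Re; simpl. ring.
    - refine (has_partials_ext_loc _ _ _ _ _ _ P2).
      apply filter_forall. intros y. unfold Im; simpl. ring. }
  assert (U00 : Cdu (fun w => RtoC (x0 (x w) + x3 (x w))) z = _)
    by exact (f_equal (fun A => entry A 0 0) HU).
  assert (U01 : Cdu (fun w => x1 (x w) + Ci * x2 (x w))%C z = _)
    by exact (f_equal (fun A => entry A 0 1) HU).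
  assert (V00 : Cdv (fun w => RtoC (x0 (x w) + x3 (x w))) z = _)
    by exact (f_equal (fun A => entry A 0 0) HV).
  assert (V01 : Cdv (fun w => x1 (x w) + Ci * x2 (x w))%C z = _)
    by exact (f_equal (fun A => entry A 0 1) HV).
  rewrite (Chas_partials_Cdu _ _ _ _ P00) in U00.
  rewrite (Chas_partials_Cdv _ _ _ _ P00) in V00.
  rewrite (Chas_partials_Cdu _ _ _ _ P01) in U01.
  rewrite (Chas_partials_Cdv _ _ _ _ P01) in V01.
  subst f g. unfold a, b, frame_alpha, frame_beta.
  rewrite exp_half in U00, U01, V00, V01.
  set (e := exp (/ 2 * sigma z)) in *.
  rewrite EF in *.
  destruct w as [w1 w2].
  assert (U00r := f_equal Re U00). assert (V00r := f_equal Re V00).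
  assert (U01r := f_equal Re U01). assert (V01r := f_equal Re V01).
  assert (U01i := f_equal Im U01). assert (V01i := f_equal Im V01).
  clear - U00r V00r U01r V01r U01i V01i.
  cbn in *.
  rewrite ?cos_neg, ?sin_neg in *.
  repeat split; lra.
Qed.

Lemma weierstrass_integrands (a b : C) : a <> 0%C ->
  (b / a * a ^ 2 = a * b)%C /\ (1 * a ^ 2 = a * a)%C /\
  (- Ci * a ^ 2 = - Ci * (a * a))%C.
Proof.
  intros Ha. repeat split; simpl; field; exact Ha.
Qed.

Lemma L4_eq (x y : L4) :
  x0 x = x0 y -> x1 x = x1 y -> x2 x = x2 y -> x3 x = x3 y -> x = y.
Proof. destruct x, y; simpl; congruence. Qed.

(** Stated for a function that agrees with a product on [Sigma] only, so that the
    integrands, which contain a quotient, need no continuity of the inverse. *)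
Lemma continuous_of_eq_mult Sigma (alpha beta f : C -> C) z : open Sigma ->
  (forall w, Sigma w -> continuous (U := C_UniformSpace) alpha w) ->
  (forall w, Sigma w -> continuous (U := C_UniformSpace) beta w) ->
  (forall w, Sigma w -> f w = (alpha w * beta w)%C) ->
  Sigma z -> continuous (U := C_UniformSpace) f z.
Proof.
  intros HO Ha Hb E Hz.
  refine (continuous_ext_loc (U := C_UniformSpace) f
    (fun w => (alpha w * beta w)%C) z _ (Cmult_continuous _ _ _ (Ha z Hz) (Hb z Hz))).
  generalize (HO z Hz). apply filter_imp. intros w Hw. symmetry. now apply E.
Qed.

Lemma weierstrass_integrands_continuous Sigma alpha beta : open Sigma ->
  holomorphic Sigma alpha -> (forall z, Sigma z -> alpha z <> 0%C) ->
  Csmooth Sigma beta ->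
  (forall z, Sigma z -> continuous (U := C_UniformSpace)
     (fun z => beta z / alpha z * alpha z ^ 2)%C z) /\
  (forall z, Sigma z -> continuous (U := C_UniformSpace)
     (fun z => 1 * alpha z ^ 2)%C z) /\
  (forall z, Sigma z -> continuous (U := C_UniformSpace)
     (fun z => - Ci * alpha z ^ 2)%C z).
Proof.
  intros HO Ha Hn Hb.
  assert (Ca := fun z Hz => holomorphic_continuous _ _ z Ha Hz).
  assert (Cb := fun z Hz => Csmooth_continuous _ _ z Hb Hz).
  assert (Caa : forall z, Sigma z -> continuous (U := C_UniformSpace)
     (fun z => 1 * alpha z ^ 2)%C z).
  { intros z Hz. apply (continuous_of_eq_mult Sigma alpha alpha); auto.
    intros w Hw. apply (weierstrass_integrands _ 0 (Hn w Hw)). }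
  repeat split; [|exact Caa|].
  - intros z Hz. apply (continuous_of_eq_mult Sigma alpha beta); auto.
    intros w Hw. apply (weierstrass_integrands _ _ (Hn w Hw)).
  - intros z Hz. apply (continuous_of_eq_mult Sigma (fun _ => - Ci)%C
      (fun z => 1 * alpha z ^ 2)%C); auto.
    + intros; apply continuous_const.
    + intros w Hw. ring.
Qed.

(** The equation between alpha and beta says that alpha d_zbar beta is real; it
    equals d_zbar (alpha beta), and alpha beta = 2 l_z. *)
Lemma frame_weierstrass Sigma x sigma F : open Sigma ->
  conformal_immersion Sigma x sigma -> adapted_frame Sigma x sigma F ->
  weierstrass_representation Sigma x (frame_alpha F sigma) (frame_beta F sigma).
Proof.
  intros HO (Hiso & (Hx & _) & Hs & _) HF.
  destruct (frame_Csmooth _ _ _ _ HO Hs HF) as [Sa Sb].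
  assert (Hn := fun z => frame_alpha_nonzero _ _ _ _ z HF).
  destruct (frame_gradient _ _ _ _ HO Hiso Hx HF) as (G0 & G1 & G2 & G3).
  destruct Hx as (X0 & X1 & X2 & X3).
  set (alpha := frame_alpha F sigma) in *. set (beta := frame_beta F sigma) in *.
  assert (Ha : holomorphic Sigma alpha)
    by exact (holomorphic_sqrt_gradient _ _ _ _ HO X1 X2 Sa Hn G1 G2).
  destruct (weierstrass_integrands_continuous _ _ _ HO Ha Hn Sb) as (C1 & C2 & C3).
  assert (I := fun z Hz => weierstrass_integrands _ (beta z) (Hn z Hz)).
  split; [exact Ha|split; [exact Hn|split; [exact Sb|split]]].
  - intros z Hz.
    assert (R := Im_d_zbar_re_primitive _ _ _ _ HO (X0 2%nat) G0 Hz).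
    rewrite (d_zbar_mult _ _ _ _ _ _ _ (Csmooth_partials _ _ _ Sa Hz)
      (Csmooth_partials _ _ _ Sb Hz)), (d_zbar_holomorphic _ _ _ Ha Hz) in R.
    rewrite d_z_conj.
    apply C_eq; revert R; unfold Re, Im; simpl; lra.
  - intros g dg Hg.
    assert (P : forall p f k, smooth Sigma p -> re_primitive Sigma p k ->
      (forall z, Sigma z -> continuous (U := C_UniformSpace) f z) ->
      (forall z, Sigma z -> f z = k z) ->
      p (g 1) = p (g 0) + Re (path_integral f g dg)).
    { intros p f k Hp Hk Hc E.
      refine (path_integral_of_gradient Sigma p f g dg HO Hc (Hp 1%nat) _ _ Hg).
      - intros z Hz. rewrite E by assumption. exact (proj1 (Hk z Hz)).
      - intros z Hz. rewrite E by assumption. exact (proj2 (Hk z Hz)). }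
    apply L4_eq; simpl.
    + refine (P _ _ _ X0 G0 C1 _). intros z Hz. apply (I z Hz).
    + refine (P _ _ _ X1 G1 C2 _). intros z Hz. apply (I z Hz).
    + refine (P _ _ _ X2 G2 C3 _). intros z Hz. apply (I z Hz).
    + refine (P _ _ _ X3 G3 C1 _). intros z Hz. apply (I z Hz).
Qed.

(** * Geometry of a Weierstrass representation *)

(** Every representation determines the differentials of the coordinates; the rest
    of the geometry is read off from them. *)
Lemma weierstrass_gradient Sigma x alpha beta : open Sigma ->
  weierstrass_representation Sigma x alpha beta ->
  re_primitive Sigma (fun z => x0 (x z)) (fun z => alpha z * beta z)%C /\
  re_primitive Sigma (fun z => x1 (x z)) (fun z => alpha z * alpha z)%C /\
  re_primitive Sigma (fun z => x2 (x z)) (fun z => - Ci * (alpha z * alpha z))%C /\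
  re_primitive Sigma (fun z => x3 (x z)) (fun z => alpha z * beta z)%C.
Proof.
  intros HO (Ha & Hn & Hb & _ & Hint).
  destruct (weierstrass_integrands_continuous _ _ _ HO Ha Hn Hb) as (C1 & C2 & C3).
  assert (I := fun z Hz => weierstrass_integrands _ (beta z) (Hn z Hz)).
  assert (P : forall p f k,
      (forall z, Sigma z -> continuous (U := C_UniformSpace) f z) ->
      (forall g dg, C1_path Sigma g dg ->
        p (g 1) = p (g 0) + Re (path_integral f g dg)) ->
      (forall z, Sigma z -> f z = k z) -> re_primitive Sigma p k).
  { intros p f k Hc Hp E z Hz. rewrite <- E by assumption.
    assert (D := gradient_of_path_integral _ _ _ _ HO Hc Hp Hz).
    split; [exact (has_partials_du _ _ _ _ D) | exact (has_partials_dv _ _ _ _ D)]. }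
  repeat apply conj.
  - refine (P _ _ _ C1 _ (fun z Hz => proj1 (I z Hz))).
    intros g dg Hg. exact (f_equal x0 (Hint g dg Hg)).
  - refine (P _ _ _ C2 _ (fun z Hz => proj1 (proj2 (I z Hz)))).
    intros g dg Hg. exact (f_equal x1 (Hint g dg Hg)).
  - refine (P _ _ _ C3 _ (fun z Hz => proj2 (proj2 (I z Hz)))).
    intros g dg Hg. exact (f_equal x2 (Hint g dg Hg)).
  - refine (P _ _ _ C1 _ (fun z Hz => proj1 (I z Hz))).
    intros g dg Hg. exact (f_equal x3 (Hint g dg Hg)).
Qed.

Lemma weierstrass_differential Sigma x alpha beta z h : open Sigma ->
  weierstrass_representation Sigma x alpha beta -> Sigma z ->
  Defs.differential x z h =
    iso_point (Re (alpha z * beta z * h)%C) (Re (alpha z * alpha z * h)%C)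
              (Im (alpha z * alpha z * h)%C).
Proof.
  intros HO HW Hz.
  destruct (weierstrass_gradient _ _ _ _ HO HW) as (G0 & G1 & G2 & G3).
  destruct (G0 z Hz) as [U0 V0], (G1 z Hz) as [U1 V1],
    (G2 z Hz) as [U2 V2], (G3 z Hz) as [U3 V3].
  unfold Defs.differential, vdu, vdv.
  rewrite U0, U1, U2, U3, V0, V1, V2, V3.
  apply L4_eq; unfold Re, Im; simpl; ring.
Qed.

(** For q = beta / alpha. As q runs through the plane, this parametrizes the
    lightlike vectors g with <g, p> = 1. *)
Definition weierstrass_gauss (q : C) : L4 :=
  vscal (- (1 / 2)) (Vec4 (1 + Cmod q ^ 2) (2 * Re q) (- 2 * Im q) (-1 + Cmod q ^ 2)).

Lemma Cmult_eq_0_r (a b : C) : a <> 0%C -> (a * b = 0)%C -> b = 0%C.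
Proof.
  intros Ha H. replace b with (/ a * (a * b))%C by (field; exact Ha).
  rewrite H. ring.
Qed.

(** Write b = q a. When <g, p> = 1, the pairing of g with the differential is
    Re (a^2 (q + g_1 - i g_2) h). It vanishes for all h exactly when g_1 = - Re q
    and g_2 = Im q; g_3 = 1 + g_0 is the normalization, and the light cone equation
    then becomes linear in g_0. *)
Lemma gauss_conditions_iff (a b : C) (g : L4) : a <> 0%C ->
  (light_cone g /\ lorentz g pp = 1 /\
   forall h, lorentz (iso_point (Re (a * b * h)%C) (Re (a * a * h)%C)
                                (Im (a * a * h)%C)) g = 0) <->
  g = weierstrass_gauss (b / a).
Proof.
  intros Ha. set (q := (b / a)%C).
  assert (Hb : b = (q * a)%C) by (unfold q; field; exact Ha).
  rewrite Hb. clearbody q. clear Hb b.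
  assert (L : forall h, lorentz g pp = 1 ->
    lorentz (iso_point (Re (a * (q * a) * h)%C) (Re (a * a * h)%C)
                                (Im (a * a * h)%C)) g
    = Re ((a * a) * (q + (x1 g, (- x2 g)%R)) * h)%C).
  { intros h. unfold lorentz, pp; simpl; intros E.
    unfold Re, Im; simpl.
    replace (x3 g) with (1 + x0 g) by lra. ring. }
  split.
  - intros (Hl & Hp & Hd).
    assert (Z : (a * (a * (q + (x1 g, (- x2 g)%R))))%C = 0%C).
    { assert (D1 := Hd (RtoC 1)). assert (D2 := Hd Ci).
      rewrite L in D1, D2 by assumption.
      revert D1 D2. unfold Re; simpl. intros D1 D2.
      apply C_eq; unfold Re, Im; simpl; lra. }
    apply (Cmult_eq_0_r _ _ Ha) in Z. apply (Cmult_eq_0_r _ _ Ha) in Z.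
    assert (E1 := f_equal Re Z). assert (E2 := f_equal Im Z).
    unfold Re, Im in E1, E2; simpl in E1, E2.
    revert Hl Hp. unfold light_cone, lorentz, pp, weierstrass_gauss. rewrite Cmod_sqr.
    destruct g as [g0 g1 g2 g3]. unfold Re, Im; simpl in *. intros Hl Hp.
    assert (g1 = - fst q) by lra. assert (g2 = snd q) by lra.
    assert (g3 = 1 + g0) by lra. subst.
    apply L4_eq; simpl; lra.
  - intros E.
    assert (Hp : lorentz g pp = 1)
      by (rewrite E; unfold lorentz, pp, weierstrass_gauss; simpl; field).
    split; [|split; [exact Hp|]].
    + rewrite E. unfold light_cone, lorentz, weierstrass_gauss. rewrite Cmod_sqr.
      simpl. field.
    + intros h. rewrite L by exact Hp. rewrite E. unfold weierstrass_gauss, Re, Im.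
      simpl. unfold Re, Im. field.
Qed.

Lemma weierstrass_gauss_map Sigma x alpha beta z : open Sigma ->
  weierstrass_representation Sigma x alpha beta -> Sigma z ->
  lightlike_gauss_map x z = weierstrass_gauss (beta z / alpha z).
Proof.
  intros HO HW Hz.
  assert (Ha : alpha z <> 0%C) by now apply HW.
  assert (K := fun g => gauss_conditions_iff (alpha z) (beta z) g Ha).
  assert (S : forall g, (light_cone g /\ lorentz g pp = 1 /\
      forall h, lorentz (Defs.differential x z h) g = 0) <->
    g = weierstrass_gauss (beta z / alpha z)).
  { intros g. rewrite <- K.
    split; intros (H1 & H2 & H3); (split; [exact H1|split; [exact H2|]]);
      intros h; specialize (H3 h);
      rewrite (weierstrass_differential _ _ _ _ _ h HO HW Hz) in *; exact H3. }
  apply S. unfold lightlike_gauss_map. apply epsilon_spec.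
  exists (weierstrass_gauss (beta z / alpha z)). now apply S.
Qed.

Lemma weierstrass_metric Sigma x alpha beta z h : open Sigma ->
  weierstrass_representation Sigma x alpha beta -> Sigma z ->
  induced_metric x z h = Cmod (alpha z) ^ 4 * (fst h ^ 2 + snd h ^ 2).
Proof.
  intros HO HW Hz. unfold induced_metric.
  rewrite (weierstrass_differential _ _ _ _ _ _ HO HW Hz).
  replace (Cmod (alpha z) ^ 4) with ((Cmod (alpha z) ^ 2) ^ 2) by ring.
  rewrite Cmod_sqr. unfold lorentz, Re, Im; simpl. ring.
Qed.

(** From x_z = f / 2 when dx = Re (f dz): the coordinates x and y have holomorphic f
    and are harmonic, and for l one has f = alpha beta with alpha holomorphic. *)
Lemma weierstrass_d_zbar_d_z Sigma x alpha beta z : open Sigma ->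
  weierstrass_representation Sigma x alpha beta -> Sigma z ->
  vd_zbar (vd_z (fun w => vmap RtoC (x w))) z =
    Vec4 (/ 2 * (alpha z * d_zbar beta z))%C 0%C 0%C
         (/ 2 * (alpha z * d_zbar beta z))%C.
Proof.
  intros HO HW Hz.
  destruct (weierstrass_gradient _ _ _ _ HO HW) as (G0 & G1 & G2 & G3).
  destruct HW as (Ha & _ & Hb & _).
  destruct (holomorphic_partials _ _ _ Ha Hz) as [l A].
  assert (B := Csmooth_partials _ _ _ Hb Hz).
  assert (Za := d_zbar_holomorphic _ _ _ Ha Hz).
  assert (AA := Chas_partials_mult _ _ _ _ _ _ _ A A).
  assert (AB := Chas_partials_mult _ _ _ _ _ _ _ A B).
  assert (P : forall p f a b, re_primitive Sigma p f -> Chas_partials f z a b ->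
    d_zbar (d_z (fun w => RtoC (p w))) z = (/ 2 * d_zbar f z)%C).
  { intros p f a b Hp Hf. rewrite <- (d_zbar_scal _ _ _ _ _ Hf).
    apply d_zbar_ext_loc. generalize (HO z Hz). apply filter_imp. intros w Hw.
    exact (d_z_re_primitive _ _ _ _ Hp Hw). }
  assert (E0 : d_zbar (fun w => alpha w * beta w)%C z = (alpha z * d_zbar beta z)%C).
  { rewrite (d_zbar_mult _ _ _ _ _ _ _ A B), Za. ring. }
  assert (E1 : d_zbar (fun w => alpha w * alpha w)%C z = 0%C).
  { rewrite (d_zbar_mult _ _ _ _ _ _ _ A A), Za. ring. }
  assert (K : Chas_partials (fun _ => - Ci)%C z 0 0)
    by (split; split; exact (is_derive_const _ _)).
  unfold vd_zbar. f_equal.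
  - rewrite <- E0. exact (P _ _ _ _ G0 AB).
  - transitivity (/ 2 * 0)%C; [|ring]. rewrite <- E1. exact (P _ _ _ _ G1 AA).
  - transitivity (/ 2 * (- Ci * 0))%C; [|ring].
    rewrite <- E1, <- (d_zbar_scal _ _ _ _ _ AA).
    exact (P _ _ _ _ G2 (Chas_partials_mult _ _ _ _ _ _ _ K AA)).
  - rewrite <- E0. exact (P _ _ _ _ G3 AB).
Qed.

(** The factor e^(2 sigma) is |alpha|^4, by comparing the two expressions of the
    metric. The pairing of g with x_z zbar reduces to the factor of p, since
    <p, g> = 1. *)
Lemma weierstrass_mean_curvature Sigma x sigma alpha beta z : open Sigma ->
  conformal_immersion Sigma x sigma ->
  weierstrass_representation Sigma x alpha beta -> Sigma z ->
  mean_curvature x sigma z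
    = (d_zbar beta z / (Cconj (alpha z) * RtoC (Cmod (alpha z) ^ 2)))%C.
Proof.
  intros HO (_ & _ & _ & Hm) HW Hz.
  assert (Ha : alpha z <> 0%C) by now apply HW.
  assert (Es : exp (2 * sigma z) = (Cmod (alpha z) ^ 2) ^ 2).
  { assert (E := Hm z (RtoC 1) Hz).
    rewrite (weierstrass_metric _ _ _ _ _ _ HO HW Hz) in E. simpl in E. simpl. lra. }
  unfold mean_curvature.
  rewrite (weierstrass_d_zbar_d_z _ _ _ _ _ HO HW Hz),
    (weierstrass_gauss_map _ _ _ _ _ HO HW Hz).
  replace (-2 * sigma z) with (- (2 * sigma z)) by ring.
  rewrite exp_Ropp, Es.
  assert (Hm2 : RtoC (Cmod (alpha z) ^ 2) = (alpha z * Cconj (alpha z))%C).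
  { rewrite Cmod_sqr. apply C_eq; unfold Re, Im; simpl; ring. }
  assert (Hpos : Cmod (alpha z) ^ 2 <> 0).
  { apply pow_nonzero. intros H. now apply Ha, Cmod_eq_0. }
  assert (Hc : Cconj (alpha z) <> 0%C).
  { intros H. apply Ha. rewrite <- (Cconj_conj (alpha z)), H.
    apply C_eq; unfold Re, Im; simpl; ring. }
  rewrite RtoC_inv by now apply pow_nonzero.
  rewrite (RtoC_pow _ 2), Hm2.
  assert (G : Clorentz
    (Vec4 (/ 2 * (alpha z * d_zbar beta z))%C 0%C 0%C (/ 2 * (alpha z * d_zbar beta z))%C)
    (vmap RtoC (weierstrass_gauss (beta z / alpha z)))
     = (/ 2 * (alpha z * d_zbar beta z))%C).
  { set (t := (/ 2 * (alpha z * d_zbar beta z))%C). clearbody t.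
    generalize (beta z / alpha z)%C. intros q. unfold Clorentz, weierstrass_gauss.
    apply C_eq; unfold Re, Im; simpl; field. }
  rewrite G. field.
  repeat split; assumption.
Qed.

Theorem theorem3p7 (Sigma : C -> Prop) (x : C -> L4) (sigma : C -> R)
    (hSigma : simply_connected_domain Sigma)
    (hx : conformal_immersion Sigma x sigma)
    (hF : exists F : C -> M2, adapted_frame Sigma x sigma F) :
  (exists alpha beta : C -> C, weierstrass_representation Sigma x alpha beta) /\
  (forall alpha beta : C -> C,
     weierstrass_representation Sigma x alpha beta ->
     forall z : C, Sigma z ->
       (forall h : C,
          induced_metric x z h = Cmod (alpha z) ^ 4 * (fst h ^ 2 + snd h ^ 2)) /\
       (mean_curvature x sigma z
          = d_zbar beta z / (Cconj (alpha z) * RtoC (Cmod (alpha z) ^ 2)))%C /\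
       lightlike_gauss_map x z
         = vscal (- (1 / 2))
             (Vec4 (1 + Cmod (beta z / alpha z)%C ^ 2)
                   (2 * Re (beta z / alpha z)%C)
                   (- 2 * Im (beta z / alpha z)%C)
                   (-1 + Cmod (beta z / alpha z)%C ^ 2))).
Proof.
  assert (HO : open Sigma) by apply hSigma.
  split.
  - destruct hF as [F HF]. exists (frame_alpha F sigma), (frame_beta F sigma).
    exact (frame_weierstrass _ _ _ _ HO hx HF).
  - intros alpha beta HW z Hz. split; [|split].
    + intros h. exact (weierstrass_metric _ _ _ _ _ h HO HW Hz).
    + exact (weierstrass_mean_curvature _ _ _ _ _ _ HO hx HW Hz).
    + exact (weierstrass_gauss_map _ _ _ _ _ HO HW Hz).
Qed.
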